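(* Let $(G, \sigma)$ be a signed graph with $\chi _{sym}(G, \sigma)= t + 2k < \chi(G)$, where $t$ is the maximum integer in $\{0,\dots,\chi(G)\}$ with $\chi_{sym}^t(G,\sigma)=\chi_{sym}(G,\sigma)$. If there exists a proper $S_{2k}^t$-coloring of $(G,\sigma)$ with a non-self-inverse color class of cardinality 3, then $\chi_{sym}(G, \sigma) \leq \Delta (G) - k +1$.
   Context: Graphs are finite multigraphs without loops (parallel edges allowed); $\chi(G)$ and $\Delta(G)$ are the ordinary chromatic number and maximum degree. A signed graph $(G,\sigma)$ is a graph $G$ with a signature $\sigma:E(G)\to\{+,-\}$. A symmetric set is a set $S$ with an involution $s\mapsto -s$ on $S$; $s$ is self-inverse if $s=-s$. $S_{2k}^t$ ($t,k\ge 0$) is the symmetric set with exactly $t$ self-inverse elements $0_1,\dots,0_t$ and $2k$ non-self-inverse elements $\pm s_1,\dots,\pm s_k$. A proper $S_{2k}^t$-coloring of $(G,\sigma)$ is a map $c:V(G)\to S_{2k}^t$ with $c(v)\ne\sigma(e)c(w)$ for every edge $e=vw$. The non-self-inverse color classes of $c$ are the sets $c^{-1}(\{s_i,-s_i\})$, $i\in\{1,\dots,k\}$. For $t\in\{0,\dots,\chi(G)\}$, $\chi_{sym}^t(G,\sigma)$ is the minimum of $t+2k$ over all $k\ge0$ for which $(G,\sigma)$ has a proper $S_{2k}^t$-coloring. The symset chromatic number is $\chi_{sym}(G,\sigma)=\min\{\chi_{sym}^t(G,\sigma): 0\le t\le\chi(G)\}$. *)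

(* Defs.v *)
From mathcomp Require Import all_boot all_order all_algebra.

Set Implicit Arguments.
Unset Strict Implicit.
Unset Printing Implicit Defensive.

(* Edges form a type of their own, so that parallel edges are distinct;
   [ends_card] excludes loops. *)
Record multigraph := Multigraph {
  vertex : finType;
  edge : finType;
  ends : edge -> {set vertex};
  ends_card : forall e, #|ends e| = 2
}.

Definition degree (G : multigraph) (v : vertex G) : nat :=
  #|[set e : edge G | v \in ends e]|.

Definition max_degree (G : multigraph) : nat := \max_(v : vertex G) degree v.

Definition proper_coloring (G : multigraph) (C : finType)
    (c : {ffun vertex G -> C}) : bool :=
  [forall e : edge G, forall v : vertex G, forall w : vertex G,
     (ends e == [set v; w]) ==> (c v != c w)].

Definition colorable (G : multigraph) (n : nat) : bool :=
  [exists c : {ffun vertex G -> 'I_n}, proper_coloring c].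

Lemma ends_neq (G : multigraph) (e : edge G) (v w : vertex G) :
  ends e = [set v; w] -> v != w.
Proof. by move=> evw; have := ends_card e; rewrite evw cards2; case: eqP. Qed.

Lemma ex_colorable (G : multigraph) : exists n, colorable G n.
Proof.
exists #|vertex G|; apply/existsP; exists [ffun v => enum_rank v].
apply/forallP=> e; apply/forallP=> v; apply/forallP=> w; apply/implyP=> /eqP evw.
by rewrite !ffunE (inj_eq enum_rank_inj) (ends_neq evw).
Qed.

Definition chromatic_number (G : multigraph) : nat := ex_minn (ex_colorable G).

Variant sign := Plus | Minus.

Definition signature (G : multigraph) := edge G -> sign.

Record symset := Symset {
  symset_sort :> finType;
  sopp : symset_sort -> symset_sort;
  soppK : involutive sopp
}.

Definition sign_act (S : symset) (s : sign) (x : S) : S :=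
  match s with Plus => x | Minus => sopp x end.

Definition self_inverse (S : symset) (x : S) : bool := sopp x == x.

(* The symmetric set S_{2k}^t: [inl j] is the self-inverse element 0_j, while
   [inr (i, false)] and [inr (i, true)] are s_i and - s_i. *)
Definition S_opp (t k : nat) (x : 'I_t + 'I_k * bool) : 'I_t + 'I_k * bool :=
  match x with
  | inl j => inl j
  | inr (i, b) => inr (i, ~~ b)
  end.

Lemma S_oppK (t k : nat) : involutive (@S_opp t k).
Proof. by case=> [j|[i b]] //=; rewrite negbK. Qed.

Definition Sset (t k : nat) : symset := Symset (@S_oppK t k).

Definition S_pos (t k : nat) (i : 'I_k) : Sset t k := inr (i, false).

Lemma card_Sset_self_inverse (t k : nat) :
  #|[set x : Sset t k | self_inverse x]| = t.
Proof.
rewrite -[RHS]card_ord -(card_imset _ (@inl_inj 'I_t ('I_k * bool)%type)).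
apply: eq_card => x; rewrite inE /self_inverse.
case: x => [j|[i b]] /=.
  by rewrite eqxx; apply/esym/imsetP; exists j.
by apply/eqP/imsetP=> [[]|[j _]] //; case: b.
Qed.

Lemma card_Sset (t k : nat) : #|Sset t k| = t + 2 * k.
Proof. by rewrite card_sum card_prod !card_ord card_bool mulnC. Qed.

Definition proper_sym_coloring (G : multigraph) (sigma : signature G)
    (S : symset) (c : {ffun vertex G -> S}) : bool :=
  [forall e : edge G, forall v : vertex G, forall w : vertex G,
     (ends e == [set v; w]) ==> (c v != sign_act (sigma e) (c w))].

Definition sym_colorable (G : multigraph) (sigma : signature G) (t k : nat) :
    bool :=
  [exists c : {ffun vertex G -> Sset t k}, proper_sym_coloring sigma c].

Definition nonself_class (G : multigraph) (t k : nat)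
    (c : {ffun vertex G -> Sset t k}) (i : 'I_k) : {set vertex G} :=
  c @^-1: [set S_pos t i; sopp (S_pos t i)].

(* The bound on k is no restriction, since n = t + 2 k forces k <= n; it only
   makes the predicate boolean. *)
Definition sym_colorable_size (G : multigraph) (sigma : signature G)
    (t n : nat) : bool :=
  [exists k : 'I_n.+1, (n == t + 2 * k) && sym_colorable sigma t k].

Lemma ex_sym_colorable_size (G : multigraph) (sigma : signature G) (t : nat) :
  exists n, sym_colorable_size sigma t n.
Proof.
set m := #|vertex G|; exists (t + 2 * m); apply/existsP.
have ltm : m < (t + 2 * m).+1 by rewrite ltnS mul2n -addnn addnA leq_addl.
exists (Ordinal ltm); rewrite eqxx /=.
apply/existsP; exists [ffun v => S_pos t (enum_rank v)].
apply/forallP=> e; apply/forallP=> v; apply/forallP=> w; apply/implyP=> /eqP evw.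
rewrite !ffunE; apply: contra (ends_neq evw).
by case: (sigma e) => /= /eqP[] // /enum_rank_inj->.
Qed.

Definition chi_sym_t (G : multigraph) (sigma : signature G) (t : nat) : nat :=
  ex_minn (ex_sym_colorable_size sigma t).

Definition chi_sym (G : multigraph) (sigma : signature G) : nat :=
  \big[minn/chi_sym_t sigma 0]_(t < (chromatic_number G).+1)
    chi_sym_t sigma t.

(* Main.v *)
Require Import Defs.
From mathcomp Require Import all_boot all_order all_algebra.
From mathcomp Require Import zify.

Set Implicit Arguments.
Unset Strict Implicit.
Unset Printing Implicit Defensive.

(* By maximality of t, no t + 2k colors suffice in which the pair {s_i, -s_i}
   is replaced by two self-inverse colors; in particular no class V_i of a pair
   is bipartite.  So a class {x, y, z} of three vertices is a triangle.  Each of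
   its vertices has a neighbor in every self-inverse class, since moving it
   there would leave a bipartite class.  The heart of the proof is that at least
   9 edges join {x, y, z} to the class V_j of any other pair: if there were
   fewer, one could split {x, y, z} and V_j together into a bipartite part and a
   part properly colored by {s_j, -s_j}.  Hence the degrees of x, y and z add up
   to at least 3t + 6 + 9(k - 1) = 3(t + 3k - 1). *)

(** * Counting edges between a triangle and the class of another pair *)

Section Bipartite.

Variables (V : finType) (adj : rel V).
Hypotheses (adj_sym : symmetric adj) (adj_irr : irreflexive adj).

Definition bipartite_on (X : {set V}) : Prop :=
  exists g : V -> bool,
    forall v w, v \in X -> w \in X -> adj v w -> g v != g w.

Lemma bipartite_on3 (X : {set V}) (p q r : V) :
  X \subset [set p; q; r] -> ~~ adj p q -> bipartite_on X.
Proof.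
move=> /subsetP sX npq; exists (fun v => v == r) => v w /sX + /sX.
rewrite !inE; have [->|_] := eqVneq v r; have [->|_] := eqVneq w r => //=.
  by rewrite adj_irr.
rewrite !orbF => /orP[] /eqP-> /orP[] /eqP->; rewrite ?adj_irr //.
  by rewrite (negbTE npq).
by rewrite adj_sym (negbTE npq).
Qed.

Lemma bipartite_on2 (X : {set V}) (p q : V) :
  X \subset [set p; q] -> bipartite_on X.
Proof.
move=> sX; apply: (@bipartite_on3 X p p q); last by rewrite adj_irr.
by rewrite setUid.
Qed.

Variables (C : {set V}) (N : bool -> V -> {set V}).

(* [C] is the class of a pair of colors, [T] the triangle, and [N b u] the set
   of neighbors of [u] in [C] that conflict with [u] when [T] is moved to the
   colors of [C], in one of the two ways [b] of matching the two pairs.  If the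
   conclusion failed, [D :|: S] could receive two new self-inverse colors. *)
Definition obstructed (T : {set V}) : Prop :=
  forall (b : bool) (S D : {set V}), S \subset T -> D \subset C ->
    (forall u, u \in T -> u \notin S -> N b u \subset D) ->
    ~ bipartite_on (D :|: S).

(** An edge from [T] to [C] conflicts under one of the two matchings, chosen by its sign; parallel
    edges of opposite signs conflict under both. *)
Definition star_neighbors (T : {set V}) : Prop :=
  forall b u a, u \in T -> a \in C ->
    adj u a = (a \in N b u) || (a \in N (~~ b) u).

Hypothesis NC : forall b u, N b u \subset C.

(** This and the next two lemmas move one, two or all three vertices of the triangle, with [S] the
    vertices left behind and [D] the least set allowed. *)
Lemma obstructed1 (x y z : V) b : obstructed [set x; y; z] ->
  ~ bipartite_on (N b x :|: [set y; z]).
Proof.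
move=> /(_ b [set y; z] (N b x)); apply=> //.
  by apply/subsetP=> v; rewrite !inE => /orP[]->; rewrite ?orbT.
by move=> u; rewrite !inE -orbA => /orP[/eqP->|->].
Qed.

Lemma obstructed2 (x y z : V) b : obstructed [set x; y; z] ->
  ~ bipartite_on (N b x :|: N b y :|: [set z]).
Proof.
move=> /(_ b [set z] (N b x :|: N b y)); apply=> //.
- by apply/subsetP=> v; rewrite !inE => ->; rewrite orbT.
- by rewrite subUset !NC.
move=> u; rewrite !inE -orbA => /or3P[/eqP->|/eqP->|->//] _.
  exact: subsetUl.
exact: subsetUr.
Qed.

Lemma obstructed3 (x y z : V) b : obstructed [set x; y; z] ->
  ~ bipartite_on (N b x :|: N b y :|: N b z).
Proof.
move=> /(_ b set0 (N b x :|: N b y :|: N b z)); rewrite setU0; apply.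
- exact: sub0set.
- by rewrite !subUset !NC.
move=> u; rewrite !inE => uT _; apply/subsetP=> a; rewrite !inE.
by case/orP: uT => [/orP[]|] /eqP-> ->; rewrite ?orbT.
Qed.

(** Invariant under permutations of the three vertices, so that each case below is treated for one
    order only. *)
Definition critical (x y z : V) : Prop :=
  obstructed [set x; y; z] /\ star_neighbors [set x; y; z].

Lemma critical_swap x y z : critical x y z -> critical y x z.
Proof. by rewrite /critical (setUC [set y]). Qed.

Lemma critical_rot x y z : critical x y z -> critical y z x.
Proof. by rewrite /critical -setUA setUC. Qed.

Lemma critical_card_gt0 x y z b : critical x y z -> 0 < #|N b x|.
Proof.
move=> [ob _]; rewrite card_gt0; apply/eqP=> N0.
by apply: (obstructed1 (b := b) ob); rewrite N0 set0U; apply: bipartite_on2.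
Qed.

(** If a claim failed, one of the obstructed sets [{p, q, z}], [{p, y, z}], [{q, x, z}] would have
    at most two vertices or a nonadjacent pair, hence be bipartite. An adjacency that [N b] does not
    account for comes from [N (~~ b)]. *)
Lemma critical_single x y z b p q : critical x y z ->
  N b x = [set p] -> N b y = [set q] ->
  [/\ p != q, adj z p, p \in N (~~ b) y & q \in N (~~ b) x].
Proof.
move=> gxyz Nx Ny; have [ob st] := gxyz.
have pC : p \in C by apply: (subsetP (NC b x)); rewrite Nx set11.
have qC : q \in C by apply: (subsetP (NC b y)); rewrite Ny set11.
have npq : p != q.
  apply/eqP=> pq; apply: (obstructed2 (b := b) ob); rewrite Nx Ny -pq setUid.
  exact: bipartite_on2.
have pz : adj z p.
  apply/negPn/negP=> npz; apply: (obstructed2 (b := b) ob); rewrite Nx Ny.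
  apply: (@bipartite_on3 _ z p q) => //.
  by apply/subsetP=> v; rewrite !inE => /orP[/orP[]|]->; rewrite ?orbT.
have py : adj y p.
  apply/negPn/negP=> npy; apply: (obstructed1 (b := b) ob); rewrite Nx.
  apply: (@bipartite_on3 _ y p z) => //.
  by apply/subsetP=> v; rewrite !inE => /or3P[]->; rewrite ?orbT.
have qx : adj x q.
  apply/negPn/negP=> nqx; apply: (obstructed1 (b := b) (critical_swap gxyz).1).
  rewrite Ny; apply: (@bipartite_on3 _ x q z) => //.
  by apply/subsetP=> v; rewrite !inE => /or3P[]->; rewrite ?orbT.
move: py qx; rewrite (st b) ?inE ?eqxx ?orbT // (st b x) ?inE ?eqxx //.
by rewrite Nx Ny !inE (negbTE npq) eq_sym (negbTE npq).
Qed.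

(** The single elements [q] of [N b y] and [r] of [N b z] are distinct and both lie in
    [N (~~ b) x]. *)
Lemma critical_all_single x y z b : critical x y z ->
  #|N b x| = 1 -> #|N b y| = 1 -> #|N b z| = 1 -> 1 < #|N (~~ b) x|.
Proof.
move=> g /eqP/cards1P[p Nx] /eqP/cards1P[q Ny] /eqP/cards1P[r Nz].
have [_ _ _ qx] := critical_single g Nx Ny.
have [nqr _ _ _] := critical_single (critical_rot g) Ny Nz.
have [_ _ rx _] := critical_single (critical_rot (critical_rot g)) Nz Nx.
apply: leq_trans (_ : #|[set q; r]| <= _); first by rewrite cards2 nqr.
by apply: subset_leq_card; rewrite subUset !sub1set qx rx.
Qed.

(** Otherwise [N b z = {p, d}], and the obstructed set [{p, d, y}] forces [y] adjacent to [d]. The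
    neighbors of [y] in [C] are [p] and [q], so [d = q], and moving all of [x], [y], [z] leaves only
    [{p, q}]. *)
Lemma critical_double_notin x y z b p q : critical x y z ->
  N b x = [set p] -> N b y = [set q] -> N (~~ b) y = [set p] ->
  #|N b z| = 2 -> p \notin N b z.
Proof.
move=> g Nx Ny Ny' Nz2; apply/negP=> pz; have [ob st] := g.
have [d /setP Nz] : exists d, N b z = [set p; d].
  have /eqP/cards1P[d Nd] : #|N b z :\ p| = 1.
    by have := cardsD1 p (N b z); rewrite pz Nz2 => -[].
  by exists d; rewrite -Nd setD1K.
have dp : d != p.
  apply/eqP=> dp; move: Nz2; rewrite (_ : N b z = [set p]) ?cards1 //.
  by apply/setP=> v; rewrite Nz dp !inE orbb.
have dC : d \in C by apply: (subsetP (NC b z)); rewrite Nz !inE eqxx orbT.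
have yd : adj y d.
  apply/negPn/negP=> nyd.
  have [ob' _] := critical_swap (critical_rot (critical_rot g)).
  apply: (obstructed2 (b := b) ob').
  apply: (@bipartite_on3 _ y d p) => //.
  apply/subsetP=> v; rewrite !inE Nz Nx !inE.
  by case: (v == p); case: (v == y); case: (v == d).
move: yd; rewrite (st b) ?inE ?eqxx ?orbT // Ny Ny' !inE (negbTE dp) orbF.
move=> /eqP dq; apply: (obstructed3 (b := b) ob).
apply: (@bipartite_on2 _ p q); apply/subsetP=> v; rewrite !inE Nz Nx Ny !inE dq.
by case: (v == p); case: (v == q).
Qed.

Lemma set1_of_card1 (A : {set V}) p : p \in A -> #|A| = 1 -> A = [set p].
Proof. by move=> + /eqP/cards1P[q Aq]; rewrite Aq inE => /eqP->. Qed.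

(** Both [p] and [q] are neighbors of [z] outside [N b z], so they make up [N (~~ b) z]; then all
    conflicts for [~~ b] lie in [{p, q}]. *)
Lemma critical_double_double x y z b : critical x y z ->
  #|N b x| = 1 -> #|N b y| = 1 -> #|N b z| = 2 ->
  #|N (~~ b) x| = 1 -> #|N (~~ b) y| = 1 -> #|N (~~ b) z| = 2 -> False.
Proof.
move=> g /eqP/cards1P[p Nx] /eqP/cards1P[q Ny] z2 x1 y1 z2'.
have [ob st] := g; have gs := critical_swap g.
have [npq zp /set1_of_card1 -/(_ y1) Ny' /set1_of_card1 -/(_ x1) Nx'] :=
  critical_single g Nx Ny.
have [_ zq _ _] := critical_single gs Ny Nx.
have pz := critical_double_notin g Nx Ny Ny' z2.
have qz := critical_double_notin gs Ny Nx Nx' z2.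
have pC : p \in C by apply: (subsetP (NC b x)); rewrite Nx set11.
have qC : q \in C by apply: (subsetP (NC b y)); rewrite Ny set11.
move: zp zq; rewrite !(st b z) ?inE ?eqxx ?orbT //.
rewrite (negbTE pz) (negbTE qz) /= => pz' qz'.
have Nz' : N (~~ b) z = [set p; q].
  apply/esym/eqP; rewrite eqEcard subUset !sub1set pz' qz' z2'.
  by rewrite cards2 npq.
apply: (obstructed3 (b := ~~ b) ob); rewrite Nx' Ny' Nz'.
apply: (@bipartite_on2 _ p q); apply/subsetP=> v; rewrite !inE.
by case: (v == p); case: (v == q).
Qed.

(** Here [N (~~ b) y = {p}], and the singletons of [y] and [z] for [~~ b] put [p] into [N b z],
    against [critical_double_notin]. *)
Lemma critical_double_mixed x y z b : critical x y z ->
  #|N b x| = 1 -> #|N b y| = 1 -> #|N b z| = 2 ->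
  #|N (~~ b) y| = 1 -> #|N (~~ b) z| = 1 -> False.
Proof.
move=> g /eqP/cards1P[p Nx] /eqP/cards1P[q Ny] z2 y1 /eqP/cards1P[f Nz'].
have [_ _ /set1_of_card1 -/(_ y1) Ny' _] := critical_single g Nx Ny.
have [_ _] := critical_single (critical_rot g) Ny' Nz'.
rewrite negbK => pz _.
by have := critical_double_notin g Nx Ny Ny' z2; rewrite pz.
Qed.

Lemma critical_two_single x y z b : critical x y z ->
  #|N b x| = 1 -> #|N b y| = 1 -> #|N b z| <= 2 ->
  9 <= #|N b x| + #|N b y| + #|N b z|
       + (#|N (~~ b) x| + #|N (~~ b) y| + #|N (~~ b) z|).
Proof.
move=> g x1 y1 z2; have gr := critical_rot g; have grr := critical_rot gr.
have x0 := critical_card_gt0 (~~ b) g.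
have y0 := critical_card_gt0 (~~ b) gr.
have z0 := critical_card_gt0 (~~ b) grr.
rewrite leqNgt; apply/negP; rewrite x1 y1 => lt9.
have [z_gt1|z_le1] := ltnP 1 #|N b z|; last first.
  have z1 : #|N b z| = 1.
    by apply/eqP; rewrite eqn_leq z_le1 (critical_card_gt0 b grr).
  move: lt9; rewrite z1.
  (* Three singletons for [b] force at least 2 for each set of [~~ b]: in all 3 + 6. *)
  move: (critical_all_single g x1 y1 z1) (critical_all_single gr y1 z1 x1).
  move: (critical_all_single grr z1 x1 y1).
  by clear; lia.
have zE : #|N b z| = 2 by apply/eqP; rewrite eqn_leq z2.
have {lt9} le4 : #|N (~~ b) x| + #|N (~~ b) y| + #|N (~~ b) z| <= 4.
  by move: lt9; rewrite zE; clear; lia.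
(* As [b] contributes 4 and [~~ b] at most 4, at most one set of [~~ b] is not a singleton, and that
   one has two elements. The cases are which one it is. *)
have [x_gt1|x_le1] := ltnP 1 #|N (~~ b) x|.
  by apply: (critical_double_mixed g x1 y1 zE);
    move: le4 x_gt1 y0 z0; clear; lia.
have [y_gt1|y_le1] := ltnP 1 #|N (~~ b) y|.
  by apply: (critical_double_mixed (critical_swap g) y1 x1 zE);
    move: le4 y_gt1 x0 z0; clear; lia.
have x1' : #|N (~~ b) x| = 1 by apply/eqP; rewrite eqn_leq x_le1.
have y1' : #|N (~~ b) y| = 1 by apply/eqP; rewrite eqn_leq y_le1.
have [z_le1|z_gt1'] := leqP #|N (~~ b) z| 1; last first.
  apply: (critical_double_double g x1 y1 zE x1' y1').
  by move: le4 z_gt1'; rewrite x1' y1'; clear; lia.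
have z1' : #|N (~~ b) z| = 1 by apply/eqP; rewrite eqn_leq z_le1.
by have := critical_all_single g x1' y1' z1'; rewrite negbK x1.
Qed.

(* If the sum were at most 8, some [b] would contribute at most 4, so that two
   of its three sets are singletons and the third has at most two elements. *)
Lemma critical_card x y z : critical x y z ->
  9 <= \sum_b (#|N b x| + #|N b y| + #|N b z|).
Proof.
move=> g; rewrite big_bool /= leqNgt; apply/negP=> lt9.
have [b lt9b le4] : exists2 b,
    #|N b x| + #|N b y| + #|N b z|
      + (#|N (~~ b) x| + #|N (~~ b) y| + #|N (~~ b) z|) < 9
    & #|N b x| + #|N b y| + #|N b z| <= 4.
  have [le|gt] := leqP (#|N true x| + #|N true y| + #|N true z|) 4.
    by exists true.
  exists false; first by rewrite addnC.
  by move: lt9 gt; clear; lia.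
have gr := critical_rot g; have grr := critical_rot gr.
have x0 := critical_card_gt0 b g; have y0 := critical_card_gt0 b gr.
have z0 := critical_card_gt0 b grr.
have [x_gt1|x_le1] := ltnP 1 #|N b x|.
  have [y1 z1 x2] : [/\ #|N b y| = 1, #|N b z| = 1 & #|N b x| <= 2].
    by split; move: le4 x_gt1 y0 z0; clear; lia.
  have := critical_two_single gr y1 z1 x2.
  by move: lt9b; clear; lia.
have x1 : #|N b x| = 1 by apply/eqP; rewrite eqn_leq x_le1.
have [y_gt1|y_le1] := ltnP 1 #|N b y|.
  have [z1 y2] : #|N b z| = 1 /\ #|N b y| <= 2.
    by split; move: le4 y_gt1 x0 z0; clear; lia.
  have := critical_two_single grr z1 x1 y2.
  by move: lt9b; clear; lia.
have y1 : #|N b y| = 1 by apply/eqP; rewrite eqn_leq y_le1.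
have z2 : #|N b z| <= 2 by move: le4; rewrite x1 y1; clear; lia.
by have := critical_two_single g x1 y1 z2; rewrite leqNgt lt9b.
Qed.

End Bipartite.

(** * Signed adjacency and recoloring in a signed graph *)

Section Links.

Variables (G : multigraph) (sigma : signature G).
Implicit Types (u v w : vertex G) (h : bool).

Definition positive (s : sign) : bool := if s is Plus then true else false.

Definition link v h w : bool :=
  [exists e : edge G, (ends e == [set v; w]) && (positive (sigma e) == h)].

Definition adjacent v w : bool := link v true w || link v false w.

Definition act (S : symset) h (x : S) : S := if h then x else sopp x.

Lemma link_sym v h w : link v h w = link w h v.
Proof. by apply: eq_existsb => e; rewrite setUC. Qed.

Lemma link_irr v h : link v h v = false.
Proof. by apply/existsP=> -[e /andP[/eqP /ends_neq]]; rewrite eqxx. Qed.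

Lemma link_adjacent v h w : link v h w -> adjacent v w.
Proof. by rewrite /adjacent; case: h => ->; rewrite ?orbT. Qed.

Lemma adjacentP v w : reflect (exists h, link v h w) (adjacent v w).
Proof.
apply: (iffP idP) => [/orP[]|[h /link_adjacent//]]; first by exists true.
by exists false.
Qed.

Lemma adjacent_sym : symmetric adjacent.
Proof. by move=> v w; rewrite /adjacent !(link_sym v). Qed.

Lemma adjacent_irr : irreflexive adjacent.
Proof. by move=> v; rewrite /adjacent !link_irr. Qed.

Lemma proper_linkP (S : symset) (c : {ffun vertex G -> S}) :
  reflect (forall v h w, link v h w -> c v != act h (c w))
          (proper_sym_coloring sigma c).
Proof.
apply: (iffP forallP) => [pc v h w|pc e].
  move=> /existsP[e /andP[eE /eqP<-]].
  move: (pc e) => /forallP/(_ v)/forallP/(_ w)/implyP/(_ eE).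
  by case: (sigma e).
apply/forallP=> v; apply/forallP=> w; apply/implyP=> eE.
have /pc : link v (positive (sigma e)) w.
  by apply/existsP; exists e; rewrite eE eqxx.
by case: (sigma e).
Qed.

(** Parallel edges count once for each sign, which is enough for a lower bound on the degree. *)
Definition star v : {set vertex G * bool} := [set p | link v p.2 p.1].

Lemma card_star v : #|star v| <= degree v.
Proof.
(* The other end of [e] with its sign; an edge at [v] has another end, so the default [v] is never
   reached there. *)
pose f (e : edge G) := (odflt v [pick w in ends e :\ v], positive (sigma e)).
apply: leq_trans (leq_imset_card f [set e | v \in ends e]).
apply/subset_leq_card/subsetP=> -[w h]; rewrite inE /=.
move=> /existsP[e /andP[/eqP eE /eqP<-]]; apply/imsetP; exists e.
  by rewrite inE eE !inE eqxx.
rewrite /f eE; congr (_, _); case: pickP => /= [a|/(_ w)].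
  by rewrite !inE => /andP[/negbTE->] /= /eqP.
by rewrite !inE eqxx orbT andbT eq_sym (ends_neq eE).
Qed.

Section Coloring.

Variables t k : nat.
Implicit Types (i j : 'I_k) (x y : Sset t k).

Definition color_class x : 'I_t + 'I_k :=
  match x with inl l => inl l | inr (i, _) => inr i end.

Definition color_sign x : bool := if x is inr (_, b) then b else false.

Lemma color_class_act h x : color_class (act h x) = color_class x.
Proof. by case: h x => -[|[]]. Qed.

Lemma color_class_inr x i : color_class x = inr i -> x = inr (i, color_sign x).
Proof. by case: x => [|[j b]] //= [->]. Qed.

Lemma act_inr h i b : act h (inr (i, b) : Sset t k) = inr (i, b (+) ~~ h).
Proof. by case: h; rewrite /= ?addbF ?addbT. Qed.

End Coloring.

(** The conditional lets signs act trivially on the two colors of pair [i]. Such a [d] turns into a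
    coloring with two more self-inverse colors once these two are renamed and the other pairs
    reindexed by [unlift]. *)
Lemma split_not_proper t k (i : 'I_k) (d : vertex G -> Sset t k) :
  ~~ sym_colorable sigma (t + 2) k.-1 ->
  ~ (forall v h w, link v h w ->
       d v != if color_class (d w) == inr i then d w else act h (d w)).
Proof.
case: k i d => [[]//|k] i d /= /negP ncol dP; apply: ncol.
pose split (x : Sset t k.+1) : Sset (t + 2) k :=
  match x with
  | inl l => inl (lshift 2 l)
  | inr (j, b) => if unlift i j is Some j' then inr (j', b)
                  else inl (rshift t (inord b))
  end.
have split_inj : injective split.
  move=> [l|[j b]] [l'|[j' b']] //=.
  - by move=> /(@inl_inj _ _ _ _)/lshift_inj->.
  - by case: unliftP => // _ /(@inl_inj _ _ _ _)/eqP; rewrite eq_lrshift.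
  - by case: unliftP => // _ /(@inl_inj _ _ _ _)/eqP; rewrite eq_rlshift.
  case: unliftP => [m ->|->]; case: unliftP => [m' ->|->] //.
    by case=> -> ->.
  move=> /(@inl_inj _ _ _ _)/rshift_inj/(congr1 val) /=.
  by rewrite !inordK ?ltnS ?leq_b1 //; case: b b' => -[].
have split_act h x :
    act h (split x) = split (if color_class x == inr i then x else act h x).
  case: x h => [l|[j b]] [] /=; rewrite ?if_same //.
  case: unliftP => [m ->|->]; last by rewrite eqxx /= unlift_none.
  rewrite (inj_eq (@inr_inj _ _)) eq_sym (negbTE (neq_lift _ _)) /=.
  by rewrite liftK.
apply/existsP; exists [ffun v => split (d v)].
by apply/proper_linkP=> v h w /dP; rewrite !ffunE split_act (inj_eq split_inj).
Qed.

(** * Recolorings that free the two colors of one pair *)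

Section Recoloring.

Variables (t k : nat) (i : 'I_k).
Hypothesis ncol : ~~ sym_colorable sigma (t + 2) k.-1.

(** Outside [X] the pair [i] does not occur, so its two colors, made self-inverse, could be given to
    the two sides of a bipartition of [X]. *)
Lemma recolor_not_bipartite (X : {set vertex G}) (d : vertex G -> Sset t k) :
  (forall v h w, v \notin X -> w \notin X -> link v h w ->
     d v != act h (d w)) ->
  (forall v, v \notin X -> color_class (d v) != inr i) ->
  ~ bipartite_on adjacent X.
Proof.
move=> dP dX [g gP].
apply: (@split_not_proper t k i
  (fun v => if v \in X then inr (i, g v) else d v) ncol) => v h w vw.
have [vX|vX] := boolP (v \in X); have [wX|wX] := boolP (w \in X) => /=.
- rewrite eqxx; apply: contra (gP v w vX wX (link_adjacent vw)).
  by move=> /eqP[->].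
- rewrite (negbTE (dX w wX)); apply: contra (dX w wX).
  by move=> /eqP/(congr1 (@color_class t k)) /=; rewrite color_class_act => <-.
- by rewrite eqxx; apply: contra (dX v vX) => /eqP->.
by rewrite (negbTE (dX w wX)) dP.
Qed.

Variable c : {ffun vertex G -> Sset t k}.
Hypothesis cP : proper_sym_coloring sigma c.

Definition fiber (l : 'I_t + 'I_k) : {set vertex G} :=
  [set v | color_class (c v) == l].

Lemma fiber_not_bipartite : ~ bipartite_on adjacent (fiber (inr i)).
Proof.
apply: (recolor_not_bipartite (d := c)) => [v h w _ _|v]; last by rewrite inE.
by have /proper_linkP := cP; apply.
Qed.

Lemma self_inverse_neighbor u l :
  u \in fiber (inr i) -> bipartite_on adjacent (fiber (inr i) :\ u) ->
  exists2 v, v \in fiber (inl l) & adjacent u v.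
Proof.
move=> ui bip; apply/exists_inP; apply: contraT => /exists_inPn nadj.
exfalso; move: bip.
apply: (@recolor_not_bipartite _ (fun v => if v == u then inl l else c v)).
  have nl h w : link u h w -> color_class (c w) != inl l.
    by move=> uw; apply: contraTN (link_adjacent uw) => ?; rewrite nadj ?inE.
  move=> v h w _ _; have [->|_] := eqVneq v u; have [->|_] := eqVneq w u.
  - by rewrite link_irr.
  - move=> /nl; apply: contra => /eqP/(congr1 (@color_class t k)) /=.
    by rewrite color_class_act => <-.
  - rewrite link_sym => /nl; apply: contra => /eqP->.
    by rewrite color_class_act.
  by have /proper_linkP := cP; apply.
by move=> v; rewrite !inE; have [|] := eqVneq v u.
Qed.

Definition sgn v : bool := color_sign (c v).

Variable j : 'I_k.
Hypothesis ij : i != j.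

(* The neighbors [a] of [u] in the class of [j] that are in conflict with [u]
   once [u] gets the color [inr (j, sgn u (+) ~~ b)]. *)
Definition conflicts (b : bool) (u : vertex G) : {set vertex G} :=
  [set a in fiber (inr j) | link u (b (+) sgn u (+) sgn a) a].

Lemma fiber_obstructed :
  obstructed adjacent (fiber (inr j)) conflicts (fiber (inr i)).
Proof.
move=> b S D /subsetP Si /subsetP Dj conf.
pose d v : Sset t k :=
  if v \in fiber (inr i) then inr (j, sgn v (+) ~~ b) else c v.
have cP' v h w : link v h w -> c v != act h (c w).
  by have /proper_linkP := cP; apply.
have dP v h w : v \in fiber (inr i) -> w \notin fiber (inr i) ->
    v \notin S -> w \notin D -> link v h w ->
    (inr (j, sgn v (+) ~~ b) : Sset t k) != act h (c w).
  move=> vi wi vS wD vw; have [wj|wj] := boolP (w \in fiber (inr j)); last first.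
    apply: contra wj => /eqP/(congr1 (@color_class t k)) /=.
    by rewrite color_class_act inE => <-.
  (* Equal colors would force [h] to be the sign in [conflicts b v], and so put [w] into [D]. *)
  have := contra (subsetP (conf v vi vS) w) wD; rewrite inE wj /=.
  move: wj; rewrite inE => /eqP/color_class_inr->; rewrite act_inr -/(sgn w).
  apply: contra => /eqP[]; move: vw.
  by case: (h) (b) (sgn v) (sgn w) => -[] [] [].
apply: (recolor_not_bipartite (d := d)) => [v h w|v]; rewrite !inE !negb_or.
  move=> /andP[vD vS] /andP[wD wS] vw; rewrite /d.
  have [vi|vi] := boolP (v \in _); have [wi|wi] := boolP (w \in _).
  (* Both vertices moved: the common shift by [~~ b] commutes with signs, so properness carries over
     from [c]. *)
  - move: (cP' v h w vw); rewrite !inE in vi wi.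
    move: vi wi => /eqP/color_class_inr-> /eqP/color_class_inr->.
    rewrite -/(sgn v) -/(sgn w) !act_inr; apply: contra => /eqP[].
    by case: (h) (b) (sgn v) (sgn w) => -[] [] [].
  - exact: dP.
  - rewrite link_sym in vw; apply: contra (dP _ _ _ wi vi wS vD vw) => /eqP->.
    by case: (h); case: (c w) => [|[]] //= *; rewrite ?soppK ?negbK.
  exact: cP'.
move=> _; rewrite /d; case: ifP => [_|]; last by rewrite inE => ->.
by apply: contra ij => /eqP[->].
Qed.

Lemma fiber_star_neighbors :
  star_neighbors adjacent (fiber (inr j)) conflicts (fiber (inr i)).
Proof.
move=> b u a _ aj; rewrite !inE; move: aj; rewrite inE => -> /=.
by rewrite /adjacent; case: b (sgn u) (sgn a) => -[] []; rewrite //= orbC.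
Qed.

(** For fixed [u] and [a] the two values of [b] ask for links of opposite signs, so the two conflict
    sets embed disjointly into the star of [u]. *)
Lemma card_conflicts u :
  \sum_b #|conflicts b u| <= #|[set p in star u | p.1 \in fiber (inr j)]|.
Proof.
pose f b a := (a, b (+) sgn u (+) sgn a) : vertex G * bool.
have f_inj b : injective (f b) by move=> a a' [].
rewrite big_bool -(card_imset _ (f_inj true)) -(card_imset _ (f_inj false)) /=.
rewrite -cardsUI (_ : _ :&: _ = set0) ?cards0 ?addn0; last first.
  apply/setP=> -[a h]; rewrite !inE; apply/negP=> /andP[].
  move=> /imsetP[a1 _ [-> ->]] /imsetP[a2 _ [->]].
  by case: (sgn u) (sgn a2) => -[].
apply/subset_leq_card/subsetP=> p; rewrite inE.
by case/orP=> /imsetP[a + ->]; rewrite !inE /= => /andP[-> ->].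
Qed.

End Recoloring.

(** * Degree count over the color classes *)

Section Counting.

Variables (t k : nat) (c : {ffun vertex G -> Sset t k}).

Definition star_fiber u l : {set vertex G * bool} :=
  [set p in star u | p.1 \in fiber c l].

Lemma card_star_fibers u : #|star u| = \sum_l #|star_fiber u l|.
Proof.
rewrite -sum1_card (partition_big (fun p => color_class (c p.1)) xpredT) //=.
apply: eq_bigr => l _; rewrite sum1dep_card.
by apply: eq_card => p; rewrite !inE.
Qed.

Lemma adjacent_star_fiber u v l :
  v \in fiber c l -> adjacent u v -> exists h, (v, h) \in star_fiber u l.
Proof. by move=> vl /adjacentP[h uv]; exists h; rewrite inE vl inE uv. Qed.

Hypotheses (ncol : ~~ sym_colorable sigma (t + 2) k.-1)
           (cP : proper_sym_coloring sigma c).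

Lemma card_star_fiber_own i u v w :
  fiber c (inr i) = [set u; v; w] -> v != w -> 1 < #|star_fiber u (inr i)|.
Proof.
move=> iE vw; have nbip := fiber_not_bipartite ncol cP.
have uv : adjacent u v.
  apply/negPn/negP=> nuv; apply: (nbip i).
  apply: (bipartite_on3 adjacent_sym adjacent_irr) nuv.
  by rewrite iE.
have uw : adjacent u w.
  apply/negPn/negP=> nuw; apply: (nbip i).
  apply: (bipartite_on3 adjacent_sym adjacent_irr (r := v)) nuw.
  by rewrite iE -!setUA (setUC [set v]).
have [|h uvh] := adjacent_star_fiber (l := inr i) _ uv.
  by rewrite iE !inE eqxx orbT.
have [|h' uwh] := adjacent_star_fiber (l := inr i) _ uw.
  by rewrite iE !inE eqxx orbT.
apply/card_gt1P; exists (v, h), (w, h'); split=> //.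
by apply: contra vw => /eqP[->].
Qed.

Lemma card_star_fiber_self_inverse i l u v w :
  fiber c (inr i) = [set u; v; w] -> 0 < #|star_fiber u (inl l)|.
Proof.
move=> iE; have [||a al ua] := @self_inverse_neighbor _ _ i ncol c cP u l.
- by rewrite iE !inE eqxx.
- apply: (bipartite_on2 adjacent_sym adjacent_irr (p := v) (q := w)).
  by rewrite iE; apply/subsetP=> a; rewrite !inE; case: (a == u).
by have [h ?] := adjacent_star_fiber al ua; apply/card_gt0P; exists (a, h).
Qed.

Lemma card_star_fiber_other i j x y z :
  fiber c (inr i) = [set x; y; z] -> i != j ->
  9 <= #|star_fiber x (inr j)| + #|star_fiber y (inr j)|
       + #|star_fiber z (inr j)|.
Proof.
move=> iE ij.
have g : critical adjacent (fiber c (inr j)) (conflicts c j) x y z.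
  rewrite /critical -iE; split; last exact: fiber_star_neighbors.
  exact: fiber_obstructed.
have sC b u : conflicts c j b u \subset fiber c (inr j).
  by apply/subsetP=> a; rewrite inE => /andP[].
apply: leq_trans (critical_card adjacent_sym adjacent_irr sC g) _.
by rewrite !big_split /= !leq_add // card_conflicts.
Qed.

(** Each self-inverse class contributes 3, the triangle itself 6, and each of the other [k - 1]
    pairs 9. The summand 3 on the right avoids a subtraction. *)
Lemma triangle_degree_sum i x y z :
  fiber c (inr i) = [set x; y; z] -> x != y -> y != z -> z != x ->
  3 * (t + 3 * k) <= 3 + (degree x + degree y + degree z).
Proof.
move=> iE xy yz zx.
have iE' : fiber c (inr i) = [set y; z; x] by rewrite iE -setUA setUC.
have iE'' : fiber c (inr i) = [set z; x; y] by rewrite iE setUC setUA.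
apply: leq_trans (_ : _ <= 3 + (#|star x| + #|star y| + #|star z|)) _; last first.
  by rewrite leq_add2l !leq_add // card_star.
rewrite !card_star_fibers -!big_split /= big_sumType /= (bigD1 i) //=.
have own : 6 <= #|star_fiber x (inr i)| + #|star_fiber y (inr i)|
                  + #|star_fiber z (inr i)|.
  have := card_star_fiber_own iE yz; have := card_star_fiber_own iE' zx.
  have := card_star_fiber_own iE'' xy; lia.
have selfs : t * 3 <= \sum_(l < t) (#|star_fiber x (inl l)|
    + #|star_fiber y (inl l)| + #|star_fiber z (inl l)|).
  rewrite -[t in t * 3]card_ord -sum_nat_const; apply: leq_sum => l _.
  have := card_star_fiber_self_inverse l iE.
  have := card_star_fiber_self_inverse l iE'.
  have := card_star_fiber_self_inverse l iE''; lia.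
have others : k.-1 * 9 <= \sum_(j < k | j != i) (#|star_fiber x (inr j)|
    + #|star_fiber y (inr j)| + #|star_fiber z (inr j)|).
  have <- : #|predC1 i| = k.-1 by rewrite cardC1 card_ord.
  rewrite -sum_nat_const; apply: leq_sum => j ji.
  by apply: (card_star_fiber_other iE); rewrite eq_sym.
apply: leq_trans (leq_add (leqnn 3) (leq_add selfs (leq_add own others))).
(* The index [i] gives [k > 0], so [k.-1] is a true predecessor. *)
have := ltn_ord i; lia.
Qed.

End Counting.

End Links.

(** * Bounds on the symset chromatic numbers and the conclusion *)

Lemma chi_sym_le (G : multigraph) (sigma : signature G) t :
  t <= chromatic_number G -> chi_sym sigma <= chi_sym_t sigma t.
Proof.
rewrite -ltnS => lt; have := mem_index_enum (Ordinal lt); rewrite /chi_sym.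
elim: (index_enum _) => // i r IH; rewrite inE big_cons geq_min.
by case/orP=> [/eqP<-|/IH->]; rewrite ?leqnn ?orbT.
Qed.

Lemma chi_sym_t_le (G : multigraph) (sigma : signature G) t k :
  sym_colorable sigma t k -> chi_sym_t sigma t <= t + 2 * k.
Proof.
move=> col; rewrite /chi_sym_t; case: ex_minnP => m _; apply.
have ltk : k < (t + 2 * k).+1 by lia.
by apply/existsP; exists (Ordinal ltk); rewrite eqxx.
Qed.

Theorem theorem3p6 (G : multigraph) (sigma : signature G) (t k : nat)
  (t_le : t <= chromatic_number G)
  (t_opt : chi_sym_t sigma t = chi_sym sigma)
  (t_max : forall t' : nat, t' <= chromatic_number G ->
             chi_sym_t sigma t' = chi_sym sigma -> t' <= t)
  (chi_symE : chi_sym sigma = t + 2 * k)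
  (chi_sym_lt : t + 2 * k < chromatic_number G)
  (class3 : exists c : {ffun vertex G -> Sset t k},
     proper_sym_coloring sigma c /\
     exists i : 'I_k, #|nonself_class c i| = 3) :
  ((chi_sym sigma)%:Z <= (max_degree G)%:Z - k%:Z + 1)%R.
Proof.
have [c [cP [i card3]]] := class3; have ltk := ltn_ord i.
have ncol : ~~ sym_colorable sigma (t + 2) k.-1.
  (* Such a coloring would again use [t + 2k] colors, making [t + 2] optimal as well; [t + 2] is
     admissible since [k > 0] and [t + 2k] is below the chromatic number. This contradicts the
     maximality of [t]. *)
  apply/negP=> /chi_sym_t_le le2.
  have le_chi : t + 2 <= chromatic_number G by lia.
  have ge2 := chi_sym_le sigma le_chi.
  by have := t_max _ le_chi; lia.
have fiberE : fiber c (inr i) = nonself_class c i.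
  apply/setP=> v; rewrite !inE; case: (c v) => [l|[j b]] //=.
  rewrite (inj_eq (@inr_inj _ _)) !(inj_eq (@inr_inj _ _)) !xpair_eqE.
  by case: b; rewrite ?andbT ?andbF ?orbF.
have /card_gt2P[x [y [z [[xi yi zi] [xy yz zx]]]]] : 2 < #|fiber c (inr i)|.
  by rewrite fiberE card3.
have iE : fiber c (inr i) = [set x; y; z].
  apply/esym/eqP; rewrite eqEcard !subUset !sub1set xi yi zi fiberE card3.
  by rewrite -setUA cardsU1 cards2 !inE negb_or xy yz eq_sym zx.
have := triangle_degree_sum ncol cP iE xy yz zx.
have degree_le (v : vertex G) : degree v <= max_degree G by exact: leq_bigmax.
have := degree_le x; have := degree_le y; have := degree_le z.
(* Bounding the three degrees by the maximum gives [3 (t + 3k) <= 3 + 3 max_degree G]; divide by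
   3. *)
rewrite chi_symE; lia.
Qed.
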